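(* Let $R$ be a commutative ring with $1$ and let $\tau$ be a symmetric relation on $R^{\#}$. Then: (1) If $R$ is a BFR, then $R$ is a $\tau$-BFR. (2) If $R$ is a $\tau$-BFR, then $R$ is a $\tau$-complete-BFR. (3) Let $R$ be $\tau$-complete and $\tau$ refinable. If $R$ is a $\tau$-complete-BFR, then $R$ is a $\tau$-BFR. (4) Let $R$ be $\tau$-completable. If $R$ is a $\tau$-complete-BFR, then $R$ is a $\tau$-BFR.
   Context: $U(R)$ is the set of units of $R$ and $R^{\#}$ the set of nonzero nonunits. A $\tau$-factorization of a nonunit $a$ is an expression $a=\lambda a_1\cdots a_n$ with $n\ge 1$, $\lambda\in U(R)$, the $a_i$ nonunits, and $a_i\,\tau\,a_j$ for all $i\ne j$; $n$ is its length. A $\tau$-refinement of a $\tau$-factorization $\lambda a_1\cdots a_n$ is a $\tau$-factorization of the form $(\lambda\lambda_1\cdots\lambda_n)b_{11}\cdots b_{1m_1}\cdots b_{n1}\cdots b_{nm_n}$ where $a_i=\lambda_i b_{i1}\cdots b_{im_i}$ is a $\tau$-factorization for each $i$. The relation $\tau$ is refinable if, for every $\tau$-factorization $\lambda a_1\cdots a_n$ and all $\tau$-factorizations $a_i=\lambda_i b_{i1}\cdots b_{im_i}$, the resulting product is a $\tau$-factorization. A $\tau$-complete factorization is a $\tau$-factorization having no $\tau$-refinement of strictly larger length. $R$ is $\tau$-complete if every nonunit has a $\tau$-complete factorization; $R$ is $\tau$-completable if every $\tau$-factorization of a nonunit can be $\tau$-refined to a $\tau$-complete factorization. $R$ is a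 $\tau$-BFR (bounded factorization ring) if for every nonunit $a$ there is a natural number $N(a)$ such that every $\tau$-factorization of $a$ has length at most $N(a)$; $R$ is a $\tau$-complete-BFR if for every nonunit $a$ there is a natural number $N(a)$ such that every $\tau$-complete factorization of $a$ has length at most $N(a)$. BFR (without $\tau$) means $\tau$-BFR for the relation $\tau=R^{\#}\times R^{\#}$, which gives the usual factorizations. *)

(* Defs.v *)
From HB Require Import structures.
From mathcomp Require Import all_boot all_order all_algebra.
Set Implicit Arguments.
Unset Strict Implicit.
Unset Printing Implicit Defensive.
Import GRing.Theory.
Local Open Scope ring_scope.

(* [comPzRingType] rather than [comUnitRingType]: the zero ring is allowed and
   no inverse operation is assumed, so units are defined by existence of an
   inverse; [is_unitE] identifies them with [GRing.unit] where the latter is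
   available. *)
Definition is_unit (R : comPzRingType) (x : R) : Prop := exists y : R, y * x = 1.

Definition nonunit (R : comPzRingType) (x : R) : Prop := ~ is_unit x.

Definition nonzero_nonunit (R : comPzRingType) (x : R) : Prop :=
  x <> 0 /\ nonunit x.

Lemma is_unitE (R : comUnitRingType) (x : R) :
  is_unit x <-> x \is a GRing.unit.
Proof.
split=> [[y yx1]|xU]; first by apply/unitrPr; exists y; rewrite mulrC.
by exists x^-1; rewrite mulVr.
Qed.

Definition relation_on_sharp (R : comPzRingType) (tau : R -> R -> Prop) : Prop :=
  forall x y : R, tau x y -> nonzero_nonunit x /\ nonzero_nonunit y.

Definition symmetric_relation (R : comPzRingType) (tau : R -> R -> Prop) : Prop :=
  forall x y : R, tau x y -> tau y x.

(* The formal expression lambda a_1 ... a_n, with its factors listed in order. *)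
Record factorization (R : comPzRingType) : Type := Factorization {
  coef : R;
  factors : seq R
}.

Definition fact_value (R : comPzRingType) (f : factorization R) : R :=
  coef f * \prod_(x <- factors f) x.

Definition fact_length (R : comPzRingType) (f : factorization R) : nat :=
  size (factors f).

(* Pairwise relatedness ranges over distinct indices, so a repeated factor x
   requires [tau x x]; for a single factor it is vacuous, so 0 = lambda 0 is a
   factorization of 0. *)
Definition tau_factorization (R : comPzRingType) (tau : R -> R -> Prop)
    (a : R) (f : factorization R) : Prop :=
  [/\ nonunit a,
      a = fact_value f,
      (1 <= fact_length f)%N /\ is_unit (coef f),
      forall i : nat, (i < fact_length f)%N -> nonunit (factors f)`_i
    & forall i j : nat, (i < fact_length f)%N -> (j < fact_length f)%N ->
        i <> j -> tau (factors f)`_i (factors f)`_j].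

Definition factorwise_tau_factorizations (R : comPzRingType)
    (tau : R -> R -> Prop) (f : factorization R)
    (gs : seq (factorization R)) : Prop :=
  size gs = fact_length f /\
  forall i : nat, (i < fact_length f)%N ->
    tau_factorization tau (factors f)`_i (nth (Factorization 0 [::]) gs i).

(* (lambda lambda_1 ... lambda_n) b_11 ... b_1m_1 ... b_n1 ... b_nm_n *)
Definition substitute (R : comPzRingType) (f : factorization R)
    (gs : seq (factorization R)) : factorization R :=
  Factorization (coef f * \prod_(g <- gs) coef g)
                (flatten [seq factors g | g <- gs]).

Definition tau_refinement (R : comPzRingType) (tau : R -> R -> Prop)
    (a : R) (f g : factorization R) : Prop :=
  [/\ tau_factorization tau a f, tau_factorization tau a g
    & exists2 gs : seq (factorization R),
        factorwise_tau_factorizations tau f gs & g = substitute f gs].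

Definition refinable (R : comPzRingType) (tau : R -> R -> Prop) : Prop :=
  forall (a : R) (f : factorization R) (gs : seq (factorization R)),
    tau_factorization tau a f -> factorwise_tau_factorizations tau f gs ->
    tau_factorization tau a (substitute f gs).

Definition tau_complete_factorization (R : comPzRingType)
    (tau : R -> R -> Prop) (a : R) (f : factorization R) : Prop :=
  tau_factorization tau a f /\
  ~ exists2 g : factorization R,
      tau_refinement tau a f g & (fact_length f < fact_length g)%N.

Definition tau_complete (R : comPzRingType) (tau : R -> R -> Prop) : Prop :=
  forall a : R, nonunit a -> exists f, tau_complete_factorization tau a f.

Definition tau_completable (R : comPzRingType) (tau : R -> R -> Prop) : Prop :=
  forall (a : R) (f : factorization R), nonunit a -> tau_factorization tau a f ->
    exists2 g, tau_refinement tau a f g & tau_complete_factorization tau a g.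

Definition tau_BFR (R : comPzRingType) (tau : R -> R -> Prop) : Prop :=
  forall a : R, nonunit a -> exists N : nat,
    forall f, tau_factorization tau a f -> (fact_length f <= N)%N.

Definition tau_complete_BFR (R : comPzRingType) (tau : R -> R -> Prop) : Prop :=
  forall a : R, nonunit a -> exists N : nat,
    forall f, tau_complete_factorization tau a f -> (fact_length f <= N)%N.

Definition BFR (R : comPzRingType) : Prop :=
  tau_BFR (fun x y : R => nonzero_nonunit x /\ nonzero_nonunit y).

(* Main.v *)
Require Import Defs.
From HB Require Import structures.
From mathcomp Require Import all_boot all_order all_algebra.

(** Parts (1) and (2) are inclusions of sets of factorizations, and (4) holds
    because refining never shortens a factorization.  For (3), when [tau] is
    refinable a factorization is complete exactly when none of its factors
    admits a factorization of length at least two.  This condition is inherited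
    by the result of substituting complete factorizations for the factors of an
    arbitrary factorization, which therefore refines to a complete one. *)

Import GRing.Theory.

(** Choosing finitely many witnesses takes only induction on [n]. This turns the mere existence of
    complete factorizations of the factors into a list that [substitute] accepts. *)
Lemma finite_choice_seq (T : Type) (x0 : T) (n : nat) (P : nat -> T -> Prop) :
  (forall i, (i < n)%N -> exists x, P i x) ->
  exists2 s : seq T, size s = n & forall i, (i < n)%N -> P i (nth x0 s i).
Proof.
elim: n => [|n IHn] Pn; first by exists [::].
have [i lt_in|s size_s Ps] := IHn; first by apply: Pn; apply: ltnW.
have [x Px] := Pn n (ltnSn n).
exists (rcons s x); first by rewrite size_rcons size_s.
move=> i; rewrite ltnS leq_eqVlt nth_rcons size_s => /predU1P[->|lt_in].
  by rewrite ltnn eqxx.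
by rewrite lt_in; apply: Ps.
Qed.

Section TauFactorization.

Variables (R : comPzRingType) (tau : R -> R -> Prop).

Local Notation fact0 := (Factorization (0%R : R) [::]).

(** Length one must be allowed: a nonunit [x] always has the trivial factorization [1 * x], and unit
    multiples give others. *)
Definition tau_irreducible (x : R) : Prop :=
  forall h, tau_factorization tau x h -> (fact_length h <= 1)%N.

Lemma fact_length_substitute (f : factorization R) (gs : seq (factorization R)) :
  fact_length (substitute f gs) =
  \sum_(i < size gs) fact_length (nth fact0 gs i).
Proof.
rewrite /fact_length size_flatten sumnE /shape -map_comp big_map.
by rewrite (big_nth fact0) big_mkord.
Qed.

(** Every factor is replaced by at least one factor, so the sum of the lengths of the pieces
    dominates a sum of ones. *)
Lemma fact_length_refinement (a : R) (f g : factorization R) :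
  tau_refinement tau a f g -> (fact_length f <= fact_length g)%N.
Proof.
move=> [_ _ [gs [size_gs fgs] ->]].
rewrite fact_length_substitute size_gs -[X in (X <= _)%N]card_ord -sum1_card.
by apply: leq_sum => i _; case: (fgs i (ltn_ord i)) => _ _ [].
Qed.

Lemma tau_factorization1 (x : R) :
  nonunit x -> tau_factorization tau x (Factorization 1%R [:: x]).
Proof.
move=> x_nonunit; split=> //.
- by rewrite /fact_value big_seq1 mul1r.
- by split=> //; exists 1%R; rewrite mulr1.
- by case.
- by case=> [|i] [|j].
Qed.

(** The length of a refinement is the sum of the lengths of its pieces, each of which is at most one
    here. *)
Lemma irreducible_complete (a : R) (f : factorization R) :
  tau_factorization tau a f ->
  (forall i, (i < fact_length f)%N -> tau_irreducible (nth 0%R (factors f) i)) ->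
  tau_complete_factorization tau a f.
Proof.
move=> ff irr_f; split=> // -[g [_ _ [gs [size_gs fgs] ->]]].
rewrite fact_length_substitute size_gs ltnNge => /negP; apply.
rewrite -[X in (_ <= X)%N]card_ord -sum1_card; apply: leq_sum => i _.
exact: irr_f (fgs i (ltn_ord i)).
Qed.

Lemma complete_irreducible (a : R) (f : factorization R) :
  refinable tau -> tau_complete_factorization tau a f ->
  forall i, (i < fact_length f)%N -> tau_irreducible (nth 0%R (factors f) i).
Proof.
move=> ref_tau [ff maxf] i lt_if h hh; rewrite leqNgt; apply/negP => gt1_h.
(* Refine only the [i]-th factor, by [h], and keep every other factor through its trivial
   factorization; refinability makes the result a factorization of [a]. *)
pose piece j :=
  if j == i then h else Factorization 1%R [:: nth 0%R (factors f) j].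
have fgs : factorwise_tau_factorizations tau f (mkseq piece (fact_length f)).
  split=> [|j lt_jf]; first by rewrite size_mkseq.
  rewrite nth_mkseq // /piece; case: eqP => [->//|_].
  by apply: tau_factorization1; case: ff => _ _ _ /(_ j lt_jf).
have gf := ref_tau _ _ _ ff fgs.
apply: maxf; exists (substitute f (mkseq piece (fact_length f))).
  by split=> //; exists (mkseq piece (fact_length f)).
rewrite fact_length_substitute size_mkseq.
rewrite -[X in (X < _)%N]card_ord -sum1_card.
(* Isolate index [i], where the length of [h] exceeds one; all other terms equal one on both
   sides. *)
rewrite (bigD1 (Ordinal lt_if)) //= [X in (_ < X)%N](bigD1 (Ordinal lt_if)) //=.
rewrite nth_mkseq // {1}/piece eqxx -addSn.
apply: leq_add => //; apply: leq_sum => j; rewrite -val_eqE /= => /negbTE ne_ji.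
by rewrite nth_mkseq // /piece ne_ji.
Qed.

(** The factors of [substitute f gs] depend only on [gs], so induction on [gs] applies: an index
    lies in the first block or, shifted by its size, in the rest. *)
Lemma substitute_irreducible (f : factorization R)
    (gs : seq (factorization R)) :
  (forall i, (i < size gs)%N -> forall k,
     (k < fact_length (nth fact0 gs i))%N ->
     tau_irreducible (nth 0%R (factors (nth fact0 gs i)) k)) ->
  forall k, (k < fact_length (substitute f gs))%N ->
    tau_irreducible (nth 0%R (factors (substitute f gs)) k).
Proof.
rewrite /fact_length /=; elim: gs => [|g gs IHgs] //= irr_gs k.
rewrite size_cat nth_cat => lt_k.
case: (ltnP k (size (factors g))) => [lt_kg|le_gk].
  exact: (irr_gs 0%N isT _ lt_kg).
apply: IHgs => [i lt_i|]; first exact: (irr_gs i.+1).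
by rewrite ltn_subLR.
Qed.

Lemma refinable_complete_completable :
  tau_complete tau -> refinable tau -> tau_completable tau.
Proof.
move=> compl_tau ref_tau a f _ ff.
have [i lt_if|gs size_gs cgs] := @finite_choice_seq _ fact0 (fact_length f)
    (fun i => tau_complete_factorization tau (nth 0%R (factors f) i)).
  by apply: compl_tau; case: ff => _ _ _ /(_ i lt_if).
have fgs : factorwise_tau_factorizations tau f gs.
  by split=> // i /cgs[].
have gf := ref_tau _ _ _ ff fgs.
exists (substitute f gs); first by split=> //; exists gs.
apply: (irreducible_complete _ _ gf); apply: substitute_irreducible => i.
by rewrite size_gs => /cgs; apply: complete_irreducible.
Qed.

Lemma completable_complete_BFR :
  tau_completable tau -> tau_complete_BFR tau -> tau_BFR tau.
Proof.
move=> compl_tau bfr a a_nonunit; have [N leN] := bfr a a_nonunit.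
(* The bound for complete factorizations of [a] serves for all, since [f] is no longer than its
   complete refinement [g]. *)
exists N => f /(compl_tau _ _ a_nonunit)[g fg /leN].
exact: leq_trans (fact_length_refinement _ _ _ fg).
Qed.

End TauFactorization.

Theorem theorem4p6 (R : comPzRingType) (tau : R -> R -> Prop)
    (tau_sharp : relation_on_sharp tau) (tau_sym : symmetric_relation tau) :
  [/\ BFR R -> tau_BFR tau,
      tau_BFR tau -> tau_complete_BFR tau,
      tau_complete tau -> refinable tau -> tau_complete_BFR tau -> tau_BFR tau
    & tau_completable tau -> tau_complete_BFR tau -> tau_BFR tau].
Proof.
split.
- move=> bfr a /bfr[N leN]; exists N => f [? ? ? ? tau_f]; apply: leN.
  (* [tau_sharp] weakens [tau] between distinct factors to the relation that defines [BFR]. *)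
  by split=> // i j lt_i lt_j ne_ij; apply: tau_sharp; apply: tau_f.
- by move=> bfr a /bfr[N leN]; exists N => f [/leN].
- move=> compl_tau ref_tau; apply: completable_complete_BFR.
  exact: refinable_complete_completable.
- exact: completable_complete_BFR.
Qed.
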